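(* Let $\psi$ be a neighbor function with distance parameters $\sigma_1,\dots,\sigma_m$, let $\mu>0$, and let $Q_{\langle G,A_i\rangle}$ be a group-by sum query with disjoint groups $g_1,\dots,g_L$ of establishments. Let $u_{j,i}$ be public upper-bound values attached to each establishment $e_j$. The probably-no-clipping mechanism for $Q_{\langle G,A_i\rangle}$ with budget $\mu$ is: (1) for each group $g_\ell$ compute $u^*_\ell=\max_{e_j\in g_\ell}u_{j,i}$; (2) compute $\Delta_\ell=u^*_\ell-\psi^{-1}\big(\max(0,\psi(u^*_\ell)-\sigma_i)\big)$; (3) compute $T_{g_\ell}=\sum_{e_j\in g_\ell}\min(r_j[A_i],u^*_\ell)$; (4) release, for each group $g_\ell$, $T_{g_\ell}+N(0,(\Delta_\ell/\mu)^2)$ (independent noise across groups) together with the variance $(\Delta_\ell/\mu)^2$. This mechanism satisfies $\mu$-Gaussian Establishment DP with neighbor function $\psi$ and distance parameters $\sigma_1,\dots,\sigma_m$.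
   Context: A neighbor function is a function $\psi:\mathbb{R}_{\geq 0}\to\mathbb{R}$ that is strictly increasing, continuous, concave, and such that $x\mapsto\psi(e^{x})$ is convex. An establishment record $r_j$ (for establishment $e_j$) consists of public attribute values and nonnegative real confidential attribute values $r_j[A_1],\dots,r_j[A_m]$. A dataset is a finite collection of such records. Given nonnegative distance parameters $\sigma_1,\dots,\sigma_m$, a record $r$ is $\psi$-close to $r'$ if their public attribute values coincide and $|\psi(r[A_k])-\psi(r'[A_k])|\leq\sigma_k$ for all $k$. Datasets $D_1,D_2$ are $\psi$-neighbors if one is obtained from the other by replacing one record $r$ with a record $r'$ that is $\psi$-close to $r$. A mechanism $M$ satisfies $\mu$-Gaussian Establishment DP (with $\psi$ and $\sigma_1,\dots,\sigma_m$) if for all pairs of $\psi$-neighbors $D_1,D_2$ and all measurable $S$, $\Phi^{-1}(P(M(D_2)\in S))\leq\Phi^{-1}(P(M(D_1)\in S))+\mu$, with $\Phi$ the standard normal CDF. A group-by sum query $Q_{\langle G,A_i\rangle}$ partitions establishments into groups via a function $G$ of the public attributes only. The upper bounds $u_{j,i}$ are public quantities (in the paper they come from an earlier, separately accounted noisy release of each $\psi(r_j[A_i])$); in this statement they are inputs to the mechanism and are not recomputed from the confidential data.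
   Formalization: The formal statement assumes ψ(0)=0 and nonnegative u_{j,i}: with ψ(0)<0 the claim fails (ψ(x)=x−1, σ=5, u*=2), with ψ(0)>0 the value ψ^{-1}(max(0,ψ(u* )−σ)) may be undefined; other ψ are handled by passing to ψ−ψ(0). *)

(* Defs.v *)
From HB Require Import structures.
From mathcomp Require Import all_boot all_order all_algebra.
From mathcomp Require Import all_classical all_reals all_analysis.
Set Implicit Arguments. Unset Strict Implicit. Unset Printing Implicit Defensive.
Import Order.TTheory GRing.Theory Num.Theory numFieldNormedType.Exports.
Local Open Scope classical_set_scope.
Local Open Scope ring_scope.

Section Defs.
Context {R : realType}.

(** Neighbor function: psi : R_{>=0} -> R (we take psi : R -> R and only
    constrain it on [0, +oo[) strictly increasing, continuous, concave,
    and x |-> psi (e^x) convex. *)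
Definition neighbor_function (psi : R -> R) : Prop :=
  [/\ (forall x y, 0 <= x -> x < y -> psi x < psi y),
      {within [set x : R | 0 <= x], continuous psi},
      (forall x y t, 0 <= x -> 0 <= y -> 0 <= t <= 1 ->
         t * psi x + (1 - t) * psi y <= psi (t * x + (1 - t) * y))
    & (forall x y t, 0 <= t <= 1 ->
         psi (expR (t * x + (1 - t) * y)) <= t * psi (expR x) + (1 - t) * psi (expR y))].

(** Inverse of psi (on its range; generalized inverse in general). *)
Definition psi_inv (psi : R -> R) (y : R) : R :=
  inf [set x : R | 0 <= x /\ y <= psi x].

Record estab_record (P : Type) (m : nat) := EstabRecord {
  pub : P ;
  conf : 'I_m -> R }.

Definition dataset (P : Type) (m : nat) (J : finType) := J -> estab_record P m.

Definition nonneg_dataset P m (J : finType) (D : dataset P m J) : Prop :=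
  forall j k, 0 <= conf (D j) k.

Definition psi_close P m (psi : R -> R) (sigma : 'I_m -> R)
  (r r' : estab_record P m) : Prop :=
  pub r = pub r' /\ forall k, `|psi (conf r k) - psi (conf r' k)| <= sigma k.

Definition psi_neighbors P m (J : finType) (psi : R -> R) (sigma : 'I_m -> R)
  (D1 D2 : dataset P m J) : Prop :=
  exists j, (forall j', j' != j -> D2 j' = D1 j') /\ psi_close psi sigma (D1 j) (D2 j).

(** Standard normal CDF and its inverse (quantile), extended-real valued:
    Phi_inv 0 = -oo, Phi_inv 1 = +oo. *)
Definition Phi (x : R) : \bar R := normal_prob 0 1 `]-oo, x].

Definition Phi_inv (p : \bar R) : \bar R :=
  ereal_inf (EFin @` [set x : R | (p <= Phi x)%E]).

(** mu-Gaussian Establishment DP for a mechanism given by its output law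
    M D : set Out -> \bar R (M D S = P(M(D) \in S)). *)
Definition gaussian_EDP P m (J : finType) d (Out : measurableType d)
  (M : dataset P m J -> set Out -> \bar R)
  (psi : R -> R) (sigma : 'I_m -> R) (mu : R) : Prop :=
  forall D1 D2 : dataset P m J,
    nonneg_dataset D1 -> nonneg_dataset D2 -> psi_neighbors psi sigma D1 D2 ->
    forall S : set Out, measurable S ->
      (Phi_inv (M D2 S) <= Phi_inv (M D1 S) + mu%:E)%E.

Definition gauss_law (c s : R) : set R -> \bar R :=
  if s == 0 then \d_ c else normal_prob c s.

Fixpoint indep_int (nus : seq (set R -> \bar R)) (f : seq R -> \bar R) : \bar R :=
  match nus with
  | [::] => f [::]
  | nu :: nus' => (\int[nu]_x indep_int nus' (fun s => f (x :: s)))%E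
  end.

Section pnc.
Variables (P : Type) (m L : nat) (J : finType).
Variables (psi : R -> R) (sigma : 'I_m -> R) (mu : R) (G : P -> 'I_L)
  (i : 'I_m) (u : J -> R).

Definition ustar (D : dataset P m J) (l : 'I_L) : R :=
  \big[Num.max/0]_(j | G (pub (D j)) == l) u j.

Definition pnc_Delta (D : dataset P m J) (l : 'I_L) : R :=
  ustar D l - psi_inv psi (Num.max 0 (psi (ustar D l) - sigma i)).

Definition group_clipped_sum (D : dataset P m J) (l : 'I_L) : R :=
  \sum_(j | G (pub (D j)) == l) Num.min (conf (D j) i) (ustar D l).

Definition pnc_sd (D : dataset P m J) (l : 'I_L) : R := pnc_Delta D l / mu.

(** Released variances (data independent given the public attributes). *)
Definition pnc_variances (D : dataset P m J) : L.-tuple R :=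
  [tuple pnc_sd D l ^+ 2 | l < L].

Definition pnc_mechanism (D : dataset P m J)
  (S : set (L.-tuple R * L.-tuple R)) : \bar R :=
  indep_int [seq gauss_law (group_clipped_sum D l) (pnc_sd D l) | l <- enum 'I_L]
    (fun s => (\1_[set s : seq R | exists t : L.-tuple R,
                     tval t = s /\ S (t, pnc_variances D)] s)%:E).

End pnc.
End Defs.

(* Main.v *)
Require Import Defs.
From HB Require Import structures.
From mathcomp Require Import all_boot all_order all_algebra.
From mathcomp Require Import all_classical all_reals all_analysis.
From mathcomp Require Import ring lra measurable_realfun.
Set Implicit Arguments.
Unset Strict Implicit.
Unset Printing Implicit Defensive.
Import Order.TTheory GRing.Theory Num.Theory numFieldNormedType.Exports.
Local Open Scope classical_set_scope.
Local Open Scope ring_scope.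

(* Neighbouring datasets share their public attributes, hence all noise scales,
   and differ in a single group sum.  Concavity of [psi] makes a clipped value
   move most when it moves up against the clipping bound; that move is
   [Delta_l], so the sum moves by at most [mu] standard deviations.

   When the means of two Gaussians differ by at most [e] standard deviations,
   the most powerful test of level [Phi x] is a ray, and it has power at most
   [Phi (x + e)].  With [l] the likelihood ratio at its end point, the
   Neyman-Pearson lemma gives, for all tests [g],
     E' g + l * Phi x <= l * E g + Phi (x + e).
   Being affine in [g], this survives integration against the noise of the
   other groups.  If [E g <= Phi x] it yields [E' g <= Phi (x + e)], and letting
   [x] vary this is the claim on [Phi_inv]. *)

Section clipping.
Context {R : realType}.
Implicit Types (a b h u s x y : R).

Lemma convex_function_increment (D : set R^o) (f : R^o -> R^o) a b h :
  convex_function D f -> D a -> D (b + h) -> a <= b -> 0 <= h ->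
  f (a + h) - f a <= f (b + h) - f b.
Proof.
move=> cvx_f Da Dbh ab h0.
have [->|h_neq0] := eqVneq h 0; first by rewrite !addr0 !subrr.
have w0 : 0 < b - a + h by rewrite ltr_wpDl ?subr_ge0// lt_def h_neq0.
pose t := h / (b - a + h).
have tw : t * (b - a + h) = h by rewrite divfK ?gt_eqF.
have t0 : 0 <= t by rewrite divr_ge0// ltW.
have t1 : t <= 1 by rewrite ler_pdivrMr// mul1r lerDr subr_ge0.
have cvx_t x y : D x -> D y ->
    f (t * x + (1 - t) * y) <= t * f x + (1 - t) * f y.
  by move=> /mem_set Dx /mem_set Dy; exact: (cvx_f (Itv01 t0 t1)).
have := cvx_t _ _ Dbh Da; have := cvx_t _ _ Da Dbh.
have -> : t * (b + h) + (1 - t) * a = a + h by lra.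
have -> : t * a + (1 - t) * (b + h) = b by lra.
lra.
Qed.

Variable psi : R -> R.
Hypothesis neighbor_psi : neighbor_function psi.

Lemma neighbor_function_homo x y : 0 <= x -> x <= y -> psi x <= psi y.
Proof.
case: neighbor_psi => psi_incr _ _ _ x0; rewrite le_eqVlt => /predU1P[->//|xy].
exact/ltW/psi_incr.
Qed.

Lemma neighbor_function_increment a b h : 0 <= a -> a <= b -> 0 <= h ->
  psi (b + h) - psi b <= psi (a + h) - psi a.
Proof.
case: neighbor_psi => _ _ concave_psi _ a0 ab h0.
have cvx_Npsi : convex_function [set x : R^o | 0 <= x] (fun x : R^o => - psi x).
  move=> t x y /set_mem x0 /set_mem y0; rewrite !convRE !mulrN -opprD lerN2.
  by apply: concave_psi => //; apply/andP.
have bh0 : 0 <= b + h by rewrite addr_ge0// (le_trans a0).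
have := @convex_function_increment _ _ a b h cvx_Npsi a0 bh0 ab h0; lra.
Qed.

Lemma psi_inv_le x y : 0 <= x -> y <= psi x -> psi_inv psi y <= x.
Proof. by move=> x0 yx; apply: ge_inf; [exists 0 => z []|split]. Qed.

Hypothesis psi0_ge0 : 0 <= psi 0.

(* By concavity, a gap [b - a] slid upwards until [b] reaches [u] gets smaller
   on the [psi] scale. *)
Lemma gap_le_sensitivity a b u s : 0 <= a -> a <= b -> b <= u ->
  psi b - psi a <= s -> b - a <= u - psi_inv psi (Num.max 0 (psi u - s)).
Proof.
move=> a0 ab bu ab_s; have ub0 : 0 <= u - b by rewrite subr_ge0.
have a_u : 0 <= a + (u - b) by rewrite addr_ge0.
suff : psi_inv psi (Num.max 0 (psi u - s)) <= a + (u - b) by lra.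
apply: psi_inv_le => //; rewrite ge_max; apply/andP; split.
  by rewrite (le_trans psi0_ge0)// neighbor_function_homo.
have := neighbor_function_increment a0 ab ub0; rewrite subrKC; lra.
Qed.

Lemma clipping_sensitivity a b u s : 0 <= a -> 0 <= b -> 0 <= u ->
  `|psi a - psi b| <= s ->
  `|Num.min a u - Num.min b u| <= u - psi_inv psi (Num.max 0 (psi u - s)).
Proof.
wlog ab : a b / a <= b => [wlog_ab a0 b0 u0|a0 b0 u0].
  have [ab|/ltW ba] := leP a b; first exact: wlog_ab.
  by rewrite (distrC (psi a)) (distrC (Num.min a u)); exact: wlog_ab.
have psi_ab := neighbor_function_homo a0 ab.
rewrite distrC ger0_norm ?subr_ge0// => psi_ab_s.
have min_ab : Num.min a u <= Num.min b u by exact: le_min2.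
rewrite distrC ger0_norm ?subr_ge0//; apply: gap_le_sensitivity => //.
- by rewrite le_min a0.
- by rewrite ge_min lexx orbT.
have [bu|/ltW ub] := leP b u; first by rewrite min_l ?(le_trans ab).
have [au|ua] := leP a u; last by rewrite subrr (le_trans _ psi_ab_s)// subr_ge0.
by have := neighbor_function_homo u0 ub; lra.
Qed.

End clipping.

Section test_functions.
Context {R : realType}.
Local Open Scope ereal_scope.

Definition test_function d (T : measurableType d) (g : T -> \bar R) : Prop :=
  measurable_fun setT g /\ forall x, 0 <= g x <= 1.

Lemma test_function_ge0 d (T : measurableType d) (g : T -> \bar R) x :
  test_function g -> 0 <= g x.
Proof. by move=> [_ /(_ x) /andP[]]. Qed.

Lemma test_function_comp d1 d2 (T1 : measurableType d1) (T2 : measurableType d2)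
    (h : T1 -> T2) (g : T2 -> \bar R) :
  measurable_fun setT h -> test_function g -> test_function (g \o h).
Proof.
move=> mh [mg g01]; split; first exact: measurableT_comp mg mh.
by move=> x; exact: g01.
Qed.

Lemma test_function_indic d (T : measurableType d) (A : set T) :
  measurable A -> test_function (fun x => (\1_A x)%:E).
Proof.
move=> mA; split; first exact/measurable_EFinP/measurable_indic.
by move=> x; rewrite !lee_fin indicE ler0n lern1 leq_b1.
Qed.

Lemma test_function_integral d1 d2 (T1 : measurableType d1)
    (T2 : measurableType d2) (P : probability T2 R) (g : T1 * T2 -> \bar R) :
  test_function g -> test_function (fun x => \int[P]_y g (x, y)).
Proof.
move=> [mg g01]; have g0 z : 0 <= g z by have /andP[] := g01 z.
split; first exact: measurable_fun_fubini_tonelli_F.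
move=> x; rewrite integral_ge0//=.
rewrite -(probability_setT P) -[leRHS]mul1e -integral_cst//.
apply: ge0_le_integral => //.
- exact: measurableT_comp.
- by move=> y _; have /andP[] := g01 (x, y).
Qed.

End test_functions.

Section neyman_pearson.
Context d (T : measurableType d) (R : realType).
Implicit Types (p q : {measure set T -> \bar R}) (A B : set T).
Local Open Scope ereal_scope.

(* Stated on sets, so that [dq/dp >= l] on [A] and [dq/dp <= l] off [A] make
   sense without densities. *)
Definition likelihood_ratio_set p q (l : R) A : Prop :=
  [/\ measurable A,
      forall B, measurable B -> B `<=` A -> l%:E * p B <= q B
    & forall B, measurable B -> B `<=` ~` A -> q B <= l%:E * p B].

Lemma ge0_le_measure_integral_in p q A (f : T -> \bar R) : measurable A ->
  (forall B, measurable B -> B `<=` A -> p B <= q B) ->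
  measurable_fun setT f -> (forall x, 0 <= f x) ->
  \int[p]_(x in A) f x <= \int[q]_(x in A) f x.
Proof.
move=> mA pq mf f0.
have restrE (m : {measure set T -> \bar R}) :
    \int[m]_(x in A) f x = \int[mrestr m mA]_(x in A) f x.
  by apply: eq_measure_integral => B mB BA; rewrite /= /mrestr setIidl.
rewrite (restrE p) (restrE q); apply: ge0_le_measure_integral => // B mB.
by rewrite /= /mrestr pq//; exact: measurableI.
Qed.

(* [q - l p] is nonnegative on [A] and nonpositive off [A], so replacing [g] by
   the indicator of [A] can only increase its integral. *)
Lemma neyman_pearson p q (l : R) A (g : T -> \bar R) : (0 <= l)%R ->
  likelihood_ratio_set p q l A -> test_function g ->
  \int[q]_x g x + l%:E * p A <= l%:E * \int[p]_x g x + q A.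
Proof.
move=> l0 [mA inA outA] [mg g01].
have g0 x : 0 <= g x by have /andP[] := g01 x.
have gfin x : g x \is a fin_num.
  by have /andP[_ g1] := g01 x; rewrite ge0_fin_numE// (le_lt_trans g1)// ltry.
have mgc : measurable_fun setT (fun x => 1 - g x) by exact: emeasurable_funB.
have gc0 x : 0 <= 1 - g x by rewrite subre_ge0//; have /andP[] := g01 x.
have mscaleE (m : {measure set T -> \bar R}) B f :
    measurable B -> measurable_fun setT f -> (forall x, 0 <= f x) ->
    \int[mscale (NngNum l0) m]_(x in B) f x = l%:E * \int[m]_(x in B) f x.
  by move=> mB mf f0; rewrite ge0_integral_mscale//; exact: measurable_funTS.
have split_test (m : {measure set T -> \bar R}) :
    \int[m]_x g x = \int[m]_(x in A) g x + \int[m]_(x in ~` A) g x.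
  rewrite -ge0_integral_setU ?setUv//; first exact: measurableC.
  exact/disj_setPCl.
have split_set (m : {measure set T -> \bar R}) :
    m A = \int[m]_(x in A) g x + \int[m]_(x in A) (1 - g x).
  rewrite -ge0_integralD//; [|exact: measurable_funTS..].
  rewrite -[LHS]mul1e -integral_cst//; apply: eq_integral => x _ /=.
  by rewrite addeC subeK.
have test_out : \int[q]_(x in ~` A) g x <= l%:E * \int[p]_(x in ~` A) g x.
  have mAc := measurableC mA; rewrite -mscaleE//.
  exact: ge0_le_measure_integral_in.
have test_in : l%:E * \int[p]_(x in A) (1 - g x) <= \int[q]_(x in A) (1 - g x).
  by rewrite -mscaleE//; exact: ge0_le_measure_integral_in.
rewrite (split_test p) (split_test q) (split_set p) (split_set q).
rewrite [in leLHS]ge0_muleDr ?integral_ge0//.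
rewrite [in leRHS]ge0_muleDr ?integral_ge0//.
rewrite addeACA [leRHS]addeACA [X in _ <= X + _]addeC.
by apply: leeD2l; exact: leeD.
Qed.

End neyman_pearson.

Section normal_cdf.
Context {R : realType}.
Implicit Types (c s t x y e : R).

Lemma normal_pdf_standardize c s y : 0 < s ->
  normal_pdf c s y = normal_pdf 0 1 ((y - c) / s) / s.
Proof.
move=> s0; rewrite !normal_pdfE ?oner_eq0 ?gt_eqF//=.
rewrite mulrAC /normal_fun /normal_peak; congr (_ * expR _).
  rewrite expr1n mul1r -mulrnAr sqrtrM ?sqr_ge0// sqrtr_sqr gtr0_norm//.
  by rewrite invfM mulrC.
by field; rewrite ?gt_eqF.
Qed.

Lemma normal_pdfN c s y : s != 0 ->
  normal_pdf (- c) s (- y) = normal_pdf c s y.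
Proof.
by move=> s0; rewrite !normal_pdfE//= /normal_fun -opprD sqrrN.
Qed.

Lemma normal_pdf_gt0 c s y : s != 0 -> 0 < normal_pdf c s y.
Proof.
by move=> s0; rewrite normal_pdfE// mulr_gt0 ?normal_peak_gt0 ?expR_gt0.
Qed.

Lemma normal_pdf_monotone_likelihood_ratio c c' s t y : s != 0 ->
  0 <= (c' - c) * (y - t) ->
  normal_pdf c' s t * normal_pdf c s y <= normal_pdf c' s y * normal_pdf c s t.
Proof.
move=> s0 ty; rewrite !normal_pdfE//= mulrACA [leRHS]mulrACA.
rewrite ler_wpM2l ?mulr_ge0 ?normal_peak_ge0// -!expRD ler_expR -!mulrDl.
rewrite ler_wpM2r ?invr_ge0 ?mulrn_wge0 ?sqr_ge0//.
by move: ty; rewrite !expr2; nra.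
Qed.

Lemma normal_prob_itvNyc c s t : 0 < s ->
  normal_prob c s `]-oo, t] = Phi ((t - c) / s).
Proof.
move=> s0; pose F : R -> R := fun y => (y - c) / s.
have dF : F^`()%classic = cst s^-1.
  apply/funext => x; rewrite /F derive1E deriveM// deriveD// derive_cst scaler0.
  by rewrite add0r derive_id derive_cst addr0 scaler1.
rewrite /Phi /normal_prob.
rewrite (@increasing_ge0_integration_by_substitutionNy _ F (normal_pdf 0 1) t).
- by apply: eq_integral => x _; rewrite dF normal_pdf_standardize.
- by move=> x y _ _ xy; rewrite /F ltr_pM2r ?invr_gt0// ltrD2r.
- by rewrite dF => x _; exact: cvg_cst.
- by rewrite dF; exact: is_cvg_cst.
- by rewrite dF; exact: cvg_cst.
- split => //.
  apply: (@cvgM R); last exact: cvg_cst.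
  by apply: (@cvgB _ R^o); [exact: cvg_at_left_filter|exact: cvg_cst].
- apply/gt0_cvgMlNy; first by rewrite invr_gt0.
  exact: cvg_addrr_Ny.
- exact/continuous_subspaceT/continuous_normal_pdf/oner_neq0.
- by move=> x _; exact: normal_pdf_ge0.
Qed.

Lemma normal_prob_itvcy c s t : 0 < s ->
  normal_prob c s `[t, +oo[ = Phi ((c - t) / s).
Proof.
move=> s0; have sn0 : s != 0 by rewrite gt_eqF.
have -> : c - t = - t - - c by rewrite opprK addrC.
rewrite -(normal_prob_itvNyc (- c) (- t) s0) /normal_prob.
rewrite ge0_integration_by_substitutionNy.
- by apply: eq_integral => x _ /=; rewrite normal_pdfN.
- exact/continuous_subspaceT/continuous_normal_pdf.
- by move=> x _; exact: normal_pdf_ge0.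
Qed.

Lemma Phi_fin_num x : Phi x \is a fin_num.
Proof. exact: fin_num_measure. Qed.

Lemma Phi_ge0 x : (0 <= Phi x)%E.
Proof. exact: measure_ge0. Qed.

Lemma Phi_nondecreasing x y : x <= y -> (Phi x <= Phi y)%E.
Proof.
by move=> xy; apply: le_measure; rewrite ?inE//; exact: subset_itvl.
Qed.

Lemma Phi_inv_le_shift (p q : \bar R) e :
  (forall x, p <= Phi x -> q <= Phi (x + e)%R)%E ->
  (Phi_inv q <= Phi_inv p + e%:E)%E.
Proof.
move=> pq; rewrite -leeBlDr//; apply: le_ereal_inf_tmp => _ [x px <-].
rewrite leeBlDr// -EFinD; apply: ereal_inf_lbound.
by exists (x + e); first exact: pq.
Qed.

End normal_cdf.

Lemma gauss_lawE (R : realType) (c s : R) (A : set R) : s != 0 ->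
  gauss_law c s A = normal_prob c s A.
Proof. by move=> s0; rewrite /gauss_law (negbTE s0). Qed.

Section gauss_law_probability.
Context {R : realType}.
Variables c s : R.

Let gauss_law0 : gauss_law c s set0 = 0%E.
Proof.
rewrite /gauss_law; case: ifP => _; last exact: measure0.
exact: (@measure0 _ R).
Qed.

Let gauss_law_ge0 A : (0 <= gauss_law c s A)%E.
Proof. by rewrite /gauss_law; case: ifP => _; exact: measure_ge0. Qed.

(* [\d_c] is a measure on [R], [normal_prob] one on [measurableTypeR R]: the
   same sigma-algebra under two displays. *)
Let gauss_law_sigma_additive : semi_sigma_additive (gauss_law c s).
Proof.
rewrite /gauss_law; case: ifP => _.
  exact: (@measure_semi_sigma_additive _ R).
exact: (@measure_semi_sigma_additive _ (measurableTypeR R) _ (normal_prob c s)).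
Qed.

HB.instance Definition _ := isMeasure.Build _ _ _
  (gauss_law c s) gauss_law0 gauss_law_ge0 gauss_law_sigma_additive.

Let gauss_law_setT : gauss_law c s setT = 1%E.
Proof.
rewrite /gauss_law; case: ifP => _.
  exact: (probability_setT (\d_c : probability R R)).
exact: (probability_setT (normal_prob c s)).
Qed.

HB.instance Definition _ :=
  @Measure_isProbability.Build _ _ R (gauss_law c s) gauss_law_setT.

End gauss_law_probability.

Section gaussian_tradeoff.
Context {R : realType}.
Implicit Types (e x l : R).
Local Open Scope ereal_scope.

(* [E] and [E'] are arbitrary functionals, since [indep_int] on sequences is not
   an integral against a measure. *)
Definition gaussian_tradeoff (X : Type) (test : (X -> \bar R) -> Prop) e
    (E E' : (X -> \bar R) -> \bar R) : Prop :=
  forall x, exists2 l, (0 <= l)%R & forall g, test g ->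
    E' g + l%:E * Phi x <= l%:E * E g + Phi (x + e).

Lemma gaussian_tradeoff_refl (X : Type) (test : (X -> \bar R) -> Prop) e E :
  (0 <= e)%R -> gaussian_tradeoff test e E E.
Proof.
move=> e0 x; exists 1%R => // g _; rewrite !mul1e leeD2l//.
by rewrite Phi_nondecreasing// lerDl.
Qed.

Lemma gaussian_tradeoff_Phi_inv (X : Type) (test : (X -> \bar R) -> Prop) e E E'
    g : gaussian_tradeoff test e E E' -> test g ->
  Phi_inv (E' g) <= Phi_inv (E g) + e%:E.
Proof.
move=> tradeoff test_g; apply: Phi_inv_le_shift => x Egx.
have [l l0 /(_ g test_g) E'g] := tradeoff x.
have lPhi_fin : l%:E * Phi x \is a fin_num by rewrite fin_numM ?Phi_fin_num.
rewrite -(leeD2rE _ _ lPhi_fin) (le_trans E'g)// addeC leeD2l//.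
by apply: lee_wpmul2l => //; rewrite lee_fin.
Qed.

Definition law_tradeoff e (p q : probability R R) : Prop :=
  gaussian_tradeoff (@test_function R _ R) e
    (fun g => \int[p]_x g x) (fun g => \int[q]_x g x).

End gaussian_tradeoff.

Section gauss_law_tradeoff.
Context {R : realType}.
Implicit Types (c s e x l t : R).
Local Open Scope ereal_scope.

Lemma le_gauss_lawZ c c' s a a' (B : set R) : s != 0%R -> (0 <= a)%R ->
  (0 <= a')%R -> measurable B ->
  (forall y, B y -> a * normal_pdf c s y <= a' * normal_pdf c' s y)%R ->
  a%:E * gauss_law c s B <= a'%:E * gauss_law c' s B.
Proof.
move=> s0 a0 a'0 mB le_pdf; rewrite !gauss_lawE//.
have mpdfZ b k : measurable_fun B
    (fun y : measurableTypeR R => (b * normal_pdf k s y)%:E).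
  apply/measurable_EFinP/measurable_funTS/measurable_funM => //.
  exact: measurable_normal_pdf.
have normal_probZ b k : (0 <= b)%R -> b%:E * normal_prob k s B =
    \int[lebesgue_measure]_(y in B) (b * normal_pdf k s y)%:E.
  move=> b0; rewrite /normal_prob -ge0_integralZl//.
  - by apply/measurable_EFinP/measurable_funTS; exact: measurable_normal_pdf.
  - by move=> y _; rewrite lee_fin normal_pdf_ge0.
rewrite !normal_probZ//; apply: ge0_le_integral => //.
- by move=> y _; rewrite lee_fin mulr_ge0 ?normal_pdf_ge0.
- exact: mpdfZ.
- exact: mpdfZ.
Qed.

Lemma gauss_law_likelihood_ratio_set c c' s t (A : set R) : s != 0%R ->
  measurable A -> (forall y, A y -> 0 <= (c' - c) * (y - t))%R ->
  (forall y, ~ A y -> (c' - c) * (y - t) <= 0)%R ->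
  likelihood_ratio_set (gauss_law c s) (gauss_law c' s)
    (normal_pdf c' s t / normal_pdf c s t) A.
Proof.
move=> s0 mA inA outA; set l := (_ / _)%R.
have l0 : (0 <= l)%R by rewrite divr_ge0 ?normal_pdf_ge0.
have pdf_t0 : (0 < normal_pdf c s t)%R by rewrite normal_pdf_gt0.
split=> // B mB BA.
- rewrite -[leRHS]mul1e; apply: le_gauss_lawZ => // y /BA/inA ty.
  rewrite mul1r mulrAC ler_pdivrMr//.
  exact: normal_pdf_monotone_likelihood_ratio.
- rewrite -[leLHS]mul1e; apply: le_gauss_lawZ => // y /BA/outA yt.
  rewrite mul1r mulrAC ler_pdivlMr//.
  apply: normal_pdf_monotone_likelihood_ratio => //.
  by rewrite -(opprB y t) mulrN oppr_ge0.
Qed.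

Lemma likelihood_ratio_set_itvcy c c' s t : s != 0%R -> (c <= c')%R ->
  likelihood_ratio_set (gauss_law c s) (gauss_law c' s)
    (normal_pdf c' s t / normal_pdf c s t) `[t, +oo[.
Proof.
move=> s0 cc'; apply: gauss_law_likelihood_ratio_set => // y /=.
  by rewrite in_itv/= andbT => ty; rewrite mulr_ge0// subr_ge0.
rewrite in_itv/= andbT => /negP; rewrite -ltNge => yt.
by rewrite mulr_ge0_le0 ?subr_ge0// subr_le0 ltW.
Qed.

Lemma likelihood_ratio_set_itvNyc c c' s t : s != 0%R -> (c' <= c)%R ->
  likelihood_ratio_set (gauss_law c s) (gauss_law c' s)
    (normal_pdf c' s t / normal_pdf c s t) `]-oo, t].
Proof.
move=> s0 c'c; apply: gauss_law_likelihood_ratio_set => // y /=.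
  by rewrite in_itv/= => yt; rewrite mulr_le0// subr_le0.
rewrite in_itv/= => /negP; rewrite -ltNge => ty.
by rewrite mulr_le0_ge0 ?subr_le0// subr_ge0 ltW.
Qed.

Lemma gauss_law_most_powerful_test c c' s e x :
  (0 < s)%R -> (`|c' - c| <= e * s)%R ->
  exists A l, [/\ (0 <= l)%R,
    likelihood_ratio_set (gauss_law c s) (gauss_law c' s) l A,
    gauss_law c s A = Phi x & gauss_law c' s A <= Phi (x + e)].
Proof.
move=> s0 cc'; have sn0 : s != 0%R by rewrite gt_eqF.
have sxK : (s * x / s = x)%R by rewrite mulrAC divff// mul1r.
pose l t : R := (normal_pdf c' s t / normal_pdf c s t)%R.
have l0 t : (0 <= l t)%R by rewrite divr_ge0 ?normal_pdf_ge0.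
have [cle|/ltW cge] := leP c c'.
- exists `[(c - s * x)%R, +oo[%classic, (l (c - s * x)%R).
  rewrite !gauss_lawE// !normal_prob_itvcy//; split=> //.
  + exact: likelihood_ratio_set_itvcy.
  + by rewrite opprB addrC subrK sxK.
  + apply: Phi_nondecreasing; rewrite ler_pdivrMr// mulrDl.
    by move: cc'; rewrite ger0_norm ?subr_ge0//; lra.
- exists `]-oo, (c + s * x)%R]%classic, (l (c + s * x)%R).
  rewrite !gauss_lawE// !normal_prob_itvNyc//; split=> //.
  + exact: likelihood_ratio_set_itvNyc.
  + by rewrite addrC addKr sxK.
  + apply: Phi_nondecreasing; rewrite ler_pdivrMr// mulrDl.
    by move: cc'; rewrite ler0_norm ?subr_le0//; lra.
Qed.

Lemma gauss_law_tradeoff c c' s e : (0 <= e)%R -> (`|c' - c| <= e * s)%R ->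
  law_tradeoff e (gauss_law c s) (gauss_law c' s).
Proof.
move=> e0 cc'; have [->|c'c] := eqVneq c' c.
  exact: gaussian_tradeoff_refl.
have s0 : (0 < s)%R.
  rewrite ltNge; apply: contra c'c => /(mulr_ge0_le0 e0)/(le_trans cc').
  by rewrite normr_le0 subr_eq0.
move=> x; have [A [l [l0 ratioA level power]]] :=
  gauss_law_most_powerful_test x s0 cc'.
exists l => // g test_g; rewrite -level.
apply: le_trans (neyman_pearson l0 ratioA test_g) _.
exact: leeD2l.
Qed.

End gauss_law_tradeoff.

Section indep_int_theory.
Context {R : realType}.
Implicit Types (p q : probability R R) (ps qs : seq (probability R R)).
Implicit Types (f : seq R -> \bar R).
Local Open Scope ereal_scope.

Definition laws ps : seq (set R -> \bar R) :=
  [seq (p : set R -> \bar R) | p <- ps].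

Definition seq_test_function n f : Prop :=
  test_function (fun t : n.-tuple R => f t).

Lemma seq_test_function_cons n f : seq_test_function n.+1 f ->
  test_function (fun z : R * n.-tuple R => f (z.1 :: z.2)).
Proof.
move=> test_f; pose cons_tuple (z : R * n.-tuple R) := [tuple of z.1 :: z.2].
apply: (test_function_comp (h := cons_tuple) _ test_f).
exact: measurable_cons.
Qed.

Lemma test_function_indep_int ps n d (Y : measurableType d)
    (F : Y -> seq R -> \bar R) : size ps = n ->
  test_function (fun z : Y * n.-tuple R => F z.1 z.2) ->
  test_function (fun y => indep_int (laws ps) (F y)).
Proof.
elim: ps n d Y F => [|p ps IH] [|n] d Y F //= => [_|[ps_n]] test_F.
  have mnil : measurable_fun setT (fun y : Y => (y, [tuple] : 0.-tuple R)).
    exact: measurable_fun_pair.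
  exact: (test_function_comp mnil test_F).
apply: (@test_function_integral _ _ _ _ _ p
  (fun z => indep_int (laws ps) (fun s => F z.1 (z.2 :: s)))).
apply: (IH n) => //.
pose assoc (z : (Y * R) * n.-tuple R) := (z.1.1, [tuple of z.1.2 :: z.2]).
apply: (test_function_comp (h := assoc) _ test_F); apply: measurable_fun_pair.
  exact: (measurableT_comp measurable_fst measurable_fst).
apply: measurable_cons => //.
exact: (measurableT_comp measurable_snd measurable_fst).
Qed.

Lemma test_function_indep_int_cons ps f :
  seq_test_function (size ps).+1 f ->
  test_function (fun x : R => indep_int (laws ps) (fun s => f (x :: s))).
Proof.
move=> /seq_test_function_cons test_f.
exact: (@test_function_indep_int ps _ _ R (fun x s => f (x :: s)) erefl).
Qed.

Lemma seq_test_function_section n f x :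
  seq_test_function n.+1 f -> seq_test_function n (fun s => f (x :: s)).
Proof.
move=> /seq_test_function_cons test_f.
by apply: (test_function_comp (h := pair x) _ test_f); exact: pair1_measurable.
Qed.

Lemma ge0_integral_probabilityDr d (T : measurableType d) (P : probability T R)
    (g : T -> \bar R) k : measurable_fun setT g -> (forall x, 0 <= g x) ->
  0 <= k -> \int[P]_x (g x + k) = \int[P]_x g x + k.
Proof.
move=> mg g0 k0; rewrite ge0_integralD// integral_cst//.
by rewrite [X in _ * X]probability_setT mule1.
Qed.

Lemma indep_int_affine_le p q ps qs l (k k' : \bar R) f : (0 <= l)%R ->
  0 <= k -> 0 <= k' ->
  (forall g, test_function g ->
    \int[q]_x g x + k <= l%:E * \int[p]_x g x + k') ->
  seq_test_function (size (ps ++ p :: qs)) f ->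
  indep_int (laws (ps ++ q :: qs)) f + k <=
  l%:E * indep_int (laws (ps ++ p :: qs)) f + k'.
Proof.
move=> l0 k0 k'0 le_pq; elim: ps f => [|r ps IH] f /= test_f.
  exact/le_pq/test_function_indep_int_cons.
have size_pq : size (ps ++ q :: qs) = size (ps ++ p :: qs) by rewrite !size_cat.
have test_p := test_function_indep_int_cons test_f.
have test_q : test_function
    (fun x => indep_int (laws (ps ++ q :: qs)) (fun s => f (x :: s))).
  by apply: test_function_indep_int_cons; rewrite size_pq.
have [[mp _] [mq _]] := (test_p, test_q).
have p0 x := test_function_ge0 x test_p.
have q0 x := test_function_ge0 x test_q.
rewrite -ge0_integralZl//.
rewrite -ge0_integral_probabilityDr// -ge0_integral_probabilityDr//.
- apply: ge0_le_integral => //.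
  + by move=> x _; rewrite adde_ge0.
  + exact: emeasurable_funD.
  + by apply: emeasurable_funD => //; exact: measurable_funeM.
  + by move=> x _; apply: IH; exact: seq_test_function_section.
- exact: measurable_funeM.
- by move=> x; rewrite mule_ge0.
Qed.

Lemma gaussian_tradeoff_indep_int p q ps qs e :
  law_tradeoff e p q ->
  gaussian_tradeoff (seq_test_function (size (ps ++ p :: qs))) e
    (indep_int (laws (ps ++ p :: qs))) (indep_int (laws (ps ++ q :: qs))).
Proof.
move=> tradeoff x; have [l l0 le_pq] := tradeoff x; exists l => // f.
by apply: indep_int_affine_le => //; rewrite ?mule_ge0 ?Phi_ge0.
Qed.

End indep_int_theory.

Lemma map_uniq_eq_except (I : eqType) (T : Type) (F F' : I -> T) (r : seq I) i :
  uniq r -> i \in r -> (forall k, k != i -> F' k = F k) ->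
  exists r1 r2, map F r = r1 ++ F i :: r2 /\ map F' r = r1 ++ F' i :: r2.
Proof.
move=> + i_r F'F; case/splitPr: r / i_r => r1 r2; rewrite cat_uniq /= negb_or.
move=> /and4P[_ /andP[i_r1 _] i_r2 _]; exists (map F r1), (map F r2).
rewrite !map_cat; split=> //; congr (_ ++ _ :: _); apply/eq_in_map => k k_r.
  by apply: F'F; apply: contraNneq i_r1 => <-.
by apply: F'F; apply: contraNneq i_r2 => <-.
Qed.

Section output_indic.
Context {R : realType} (L : nat).
Implicit Types (S : set (L.-tuple R * L.-tuple R)) (v : L.-tuple R).

Definition output_indic S v (s : seq R) : \bar R :=
  (\1_[set s : seq R | exists t : L.-tuple R, tval t = s /\ S (t, v)] s)%:E.

Lemma seq_test_function_output_indic S v : measurable S ->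
  seq_test_function L (output_indic S v).
Proof.
move=> mS; rewrite /seq_test_function.
have -> : (fun t : L.-tuple R => output_indic S v t) =
          (fun t => (\1_[set t | S (t, v)] t)%:E).
  apply/funext => t; rewrite /output_indic !indicE; congr (_%:R%:E).
  congr nat_of_bool; apply/idP/idP; rewrite !inE /=; last by exists t.
  by move=> [t' [/val_inj->]].
apply: test_function_indic; rewrite -[X in measurable X]setTI.
exact: (pair2_measurable v).
Qed.

End output_indic.

Section neighbors.
Context {R : realType} (P : Type) (m L : nat) (J : finType).
Variables (psi : R -> R) (sigma : 'I_m -> R) (mu : R) (G : P -> 'I_L).
Variables (i : 'I_m) (u : J -> R).
Implicit Types (D : @dataset R P m J) (l : 'I_L).
Implicit Types (S : set (L.-tuple R * L.-tuple R)).

Lemma ustar_ge0 D l : 0 <= ustar G u D l.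
Proof. exact: bigmax_ge_id. Qed.

Definition pnc_law D l : probability R R :=
  gauss_law (group_clipped_sum G i u D l) (pnc_sd psi sigma mu G i u D l).

Lemma pnc_mechanism_laws D S : pnc_mechanism psi sigma mu G i u D S =
  indep_int (laws [seq pnc_law D l | l <- enum 'I_L])
    (output_indic S (pnc_variances psi sigma mu G i u D)).
Proof. by rewrite /laws -map_comp. Qed.

Variables D1 D2 : @dataset R P m J.

Lemma psi_neighbors_pub : psi_neighbors psi sigma D1 D2 ->
  forall j, pub (D2 j) = pub (D1 j).
Proof.
move=> [j [D21 [pub_j _]]] k.
by have [->|kj] := eqVneq k j; [rewrite pub_j|rewrite D21].
Qed.

Hypothesis pub12 : forall j, pub (D2 j) = pub (D1 j).

Lemma ustar_pub l : ustar G u D2 l = ustar G u D1 l.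
Proof. by apply: eq_bigl => j; rewrite pub12. Qed.

Lemma pnc_sd_pub l :
  pnc_sd psi sigma mu G i u D2 l = pnc_sd psi sigma mu G i u D1 l.
Proof. by rewrite /pnc_sd /pnc_Delta ustar_pub. Qed.

Lemma pnc_variances_pub :
  pnc_variances psi sigma mu G i u D2 = pnc_variances psi sigma mu G i u D1.
Proof. by apply: eq_from_tnth => l; rewrite !tnth_mktuple pnc_sd_pub. Qed.

Variable j : J.
Hypothesis D21 : forall j', j' != j -> D2 j' = D1 j'.

Lemma group_clipped_sum_other l : l != G (pub (D1 j)) ->
  group_clipped_sum G i u D2 l = group_clipped_sum G i u D1 l.
Proof.
move=> lj; apply: eq_big => k; first by rewrite pub12.
rewrite pub12 ustar_pub => /eqP kl; rewrite D21//.
by apply: contraNneq lj => <-; rewrite kl.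
Qed.

Lemma pnc_law_other l : l != G (pub (D1 j)) -> pnc_law D2 l = pnc_law D1 l.
Proof. by move=> lj; rewrite /pnc_law pnc_sd_pub group_clipped_sum_other. Qed.

Lemma group_clipped_sum_changed (l := G (pub (D1 j))) :
  group_clipped_sum G i u D2 l - group_clipped_sum G i u D1 l =
  Num.min (conf (D2 j) i) (ustar G u D1 l) -
  Num.min (conf (D1 j) i) (ustar G u D1 l).
Proof.
rewrite /group_clipped_sum (bigD1 j) ?pub12//= [X in _ - X](bigD1 j)//=.
rewrite ustar_pub opprD addrACA -[RHS]addr0; congr +%R; apply/eqP.
rewrite subr_eq0; apply/eqP/eq_big => k; first by rewrite pub12.
by move=> /andP[_ kj]; rewrite D21.
Qed.

Hypothesis neighbor_psi : neighbor_function psi.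
Hypothesis psi0_ge0 : 0 <= psi 0.
Hypothesis mu0 : 0 < mu.
Hypothesis D1_ge0 : nonneg_dataset D1.
Hypothesis D2_ge0 : nonneg_dataset D2.
Hypothesis close12 : psi_close psi sigma (D1 j) (D2 j).

Lemma group_clipped_sum_sensitivity (l := G (pub (D1 j))) :
  `|group_clipped_sum G i u D2 l - group_clipped_sum G i u D1 l| <=
  mu * pnc_sd psi sigma mu G i u D1 l.
Proof.
case: close12 => _ close_conf.
rewrite /pnc_sd mulrC divfK ?gt_eqF// group_clipped_sum_changed distrC.
by apply: clipping_sensitivity => //; exact: ustar_ge0.
Qed.

Lemma pnc_law_tradeoff (l := G (pub (D1 j))) :
  law_tradeoff mu (pnc_law D1 l) (pnc_law D2 l).
Proof.
rewrite /pnc_law pnc_sd_pub; apply: gauss_law_tradeoff; first exact: ltW.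
exact: group_clipped_sum_sensitivity.
Qed.

End neighbors.

Theorem theorem6p9 (R : realType) (P : Type) (m L : nat) (J : finType)
  (psi : R -> R) (sigma : 'I_m -> R) (mu : R) (G : P -> 'I_L)
  (i : 'I_m) (u : J -> R) :
  neighbor_function psi -> psi 0 = 0 ->
  (forall k, 0 <= sigma k) -> 0 < mu ->
  (forall j, 0 <= u j) ->
  gaussian_EDP (pnc_mechanism psi sigma mu G i u) psi sigma mu.
Proof.
move=> npsi psi0 _ mu0 _ D1 D2 D1_ge0 D2_ge0 D12 S mS.
have pub12 := psi_neighbors_pub D12; have [j [D21 close12]] := D12.
have psi0_ge0 : 0 <= psi 0 by rewrite psi0.
pose law D := pnc_law psi sigma mu G i u D.
have law12 l : l != G (pub (D1 j)) -> law D2 l = law D1 l.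
  exact: pnc_law_other.
have changed_enum : G (pub (D1 j)) \in enum 'I_L by rewrite mem_enum.
have [ps [qs [laws1 laws2]]] :=
  map_uniq_eq_except (enum_uniq _) changed_enum law12.
have size_laws : size (ps ++ law D1 (G (pub (D1 j))) :: qs) = L.
  by rewrite -laws1 size_map size_enum_ord.
rewrite !pnc_mechanism_laws (pnc_variances_pub psi sigma mu G i u pub12).
rewrite laws1 laws2.
apply: gaussian_tradeoff_Phi_inv.
  exact/gaussian_tradeoff_indep_int/pnc_law_tradeoff.
by rewrite size_laws; exact: seq_test_function_output_indic.
Qed.
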